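(* Suppose that: (a) for every $x\in\mathbb X$ and every $t>0$, $\mathbb P^x[\max_{s\in[0,t]}X_s>x]=\mathbb P^x[\min_{s\in[0,t]}X_s<x]=1$; (b) for every $x\in\mathbb X$, $\delta(t)f(X^x_t)\to 0$ as $t\to\infty$, $\mathbb P^x$-a.s.; (c) for every $x\in\mathbb X$, $\mathbb E^x\big[\sup_{t\in[0,\infty)}\delta(t)f(X_t)\big]<\infty$. Then for any closed $R,T\in\mathcal E$, $$J(x,R\cap T)\ge \max\{J(x,R),J(x,T)\}\qquad\forall x\in\mathbb X.$$ Hence $R\cap T$ also belongs to $\mathcal E$.
   Context: $X=(X_t)_{t\ge 0}$ is a time-homogeneous continuous strong Markov process on a probability space $(\Omega,\mathcal F,\mathbb P)$, taking values in an interval $\mathbb X\subseteq\mathbb R$. $\mathcal B(\mathbb X)$ is the collection of Borel subsets of $\mathbb X$; $\mathbb P^x,\mathbb E^x$ denote probability and expectation given $X_0=x$, and $X^x$ denotes $X$ started at $x\in\mathbb X$. The payoff function $f:\mathbb X\to[0,\infty)$ is continuous. The discount function $\delta:[0,\infty)\to(0,1]$ is non-increasing and continuous, with $\delta(0)=1$, $\delta(t)\to0$ as $t\to\infty$, and is log sub-additive: $\delta(s)\delta(t)\le\delta(s+t)$ for all $s,t>0$. For $x\in\mathbb X$, $R\in\mathcal B(\mathbb X)$: $\rho(x,R):=\inf\{t>0: X^x_t\in R\}$ ($\inf\emptyset=\infty$) and $J(x,R):=\mathbb E^x[\delta(\rho(x,R))f(X_{\rho(x,R)})]$, where on $\{\rho(x,R)=\infty\}$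 the integrand is taken to be $\limsup_{t\to\infty}\delta(t)f(X^x_t)$. Put $S_R:=\{x: f(x)>J(x,R)\}$, $I_R:=\{x: f(x)=J(x,R)\}$, and $\Theta(R):=S_R\cup(I_R\cap R)$. $R\in\mathcal B(\mathbb X)$ is an equilibrium if $\Theta(R)=R$; $\mathcal E$ is the set of all equilibria. ''Closed'' means closed relative to $\mathbb X$. *)

(* Defs.v *)
From HB Require Import structures.
From mathcomp Require Import all_boot all_order all_algebra.
From mathcomp Require Import all_classical all_reals all_analysis measurable_realfun.
Import Order.TTheory GRing.Theory Num.Theory.
Import numFieldNormedType.Exports.

Set Implicit Arguments.
Unset Strict Implicit.
Unset Printing Implicit Defensive.

Local Open Scope classical_set_scope.
Local Open Scope ring_scope.

(* A process is a function X : R -> T -> R whose values at times t < 0 are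
   irrelevant. The state space is an interval I of R, and a family of laws is
   a function P : R -> probability T R of which only the P x with x in I
   matter. *)

(* sigma(X_s : 0 <= s <= t) *)
Definition natural_filtration (d : measure_display) (T : measurableType d)
    (R : realType) (X : R -> T -> R) (t : R) : set (set T) :=
  <<s [set A | exists (s : R) (B : set R),
         [/\ 0 <= s <= t, measurable B & A = X s @^-1` B] ]>>.

Definition right_limit_filtration (T : Type) (R : realType)
    (F : R -> set (set T)) (t : R) : set (set T) :=
  [set A | forall s : R, t < s -> F s A].

Definition stopping_time (T : Type) (R : realType) (F : R -> set (set T))
    (tau : T -> \bar R) : Prop :=
  (forall w, (0 <= tau w)%E) /\
  (forall t : R, 0 <= t -> F t [set w | (tau w <= t%:E)%E]).

(* The sigma-algebra F_tau of events prior to the stopping time tau *)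
Definition stopped_sigma_algebra (d : measure_display) (T : measurableType d)
    (R : realType) (F : R -> set (set T)) (tau : T -> \bar R) : set (set T) :=
  [set A | measurable A /\
     forall t : R, 0 <= t -> F t (A `&` [set w | (tau w <= t%:E)%E])].

(* The product sigma-algebra on paths, generated by the coordinates t >= 0 *)
Definition path_sigma_algebra (R : realType) : set (set (R -> R)) :=
  <<s [set C | exists (t : R) (B : set R),
         [/\ 0 <= t, measurable B & C = [set p : R -> R | B (p t)]] ]>>.

(* X is a time-homogeneous continuous strong Markov process with state space I,
   P x being its law when started at x. The last field says that, for every
   stopping time tau of the right-continuous filtration F_{t+} generated by X,
   on {tau < +oo} the conditional law under P x of the path (X_{tau + t})_t
   given F_{tau+} is the law of X under P (X_tau):
     P x [X_{tau + .} \in C | F_{tau+}] = P (X_tau) [X \in C]  on {tau < +oo},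
   where the conditional probability is characterized by integration over the
   events G of F_{tau+} contained in {tau < +oo}. *)
Record strong_markov_process (d : measure_display) (T : measurableType d)
    (R : realType) (I : set R) (P : R -> probability T R) (X : R -> T -> R) :
    Prop := StrongMarkovProcess {
  smp_measurable : forall t : R, 0 <= t -> measurable_fun setT (X t) ;
  smp_state : forall (t : R) (w : T), 0 <= t -> I (X t w) ;
  smp_continuous : forall w, {within `[0, +oo[, continuous (fun t => X t w)} ;
  smp_start : forall x, I x -> P x [set w | X 0 w = x] = 1%E ;
  smp_kernel : forall C, path_sigma_algebra C ->
    measurable_fun I (fun x => P x [set w | C (fun t => X t w)]) ;
  smp_strong_markov : forall x, I x ->
    forall tau : T -> \bar R,
    let F := right_limit_filtration (natural_filtration X) in
    stopping_time F tau ->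
    forall G, stopped_sigma_algebra F tau G ->
    G `<=` [set w | (tau w < +oo)%E] ->
    forall C, path_sigma_algebra C ->
    P x (G `&` [set w | C (fun t => X (fine (tau w) + t) w)]) =
    (\int[P x]_(w in G)
       P (X (fine (tau w)) w) [set w' | C (fun t => X t w')])%E }.

Record discount_function (R : realType) (delta : R -> R) : Prop :=
  DiscountFunction {
  discount_range : forall t : R, 0 <= t -> 0 < delta t <= 1 ;
  discount_nonincreasing :
    forall s t : R, 0 <= s -> s <= t -> delta t <= delta s ;
  discount_continuous : {within `[0, +oo[, continuous delta} ;
  discount0 : delta 0 = 1 ;
  discount_cvg0 : delta t @[t --> +oo] --> 0 ;
  discount_log_subadditive :
    forall s t : R, 0 < s -> 0 < t -> delta s * delta t <= delta (s + t) }.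

(* The infimum of the empty set is +oo. *)
Definition hitting_time (T : Type) (R : realType) (X : R -> T -> R)
    (A : set R) (w : T) : \bar R :=
  ereal_inf [set t%:E | t in [set t : R | 0 < t /\ A (X t w)] ].

Definition stopped_payoff (T : Type) (R : realType) (X : R -> T -> R)
    (f delta : R -> R) (A : set R) (w : T) : \bar R :=
  if hitting_time X A w is t%:E then (delta t * f (X t w))%:E
  else limf_esup (fun t => (delta t * f (X t w))%:E) (pinfty_nbhs R).

Definition J (d : measure_display) (T : measurableType d) (R : realType)
    (P : R -> probability T R) (X : R -> T -> R) (f delta : R -> R)
    (x : R) (A : set R) : \bar R :=
  (\int[P x]_w stopped_payoff X f delta A w)%E.

Definition stopping_region (d : measure_display) (T : measurableType d)
    (R : realType) (I : set R) (P : R -> probability T R) (X : R -> T -> R)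
    (f delta : R -> R) (A : set R) : set R :=
  [set x | I x /\ (J P X f delta x A < (f x)%:E)%E].

Definition indifference_region (d : measure_display) (T : measurableType d)
    (R : realType) (I : set R) (P : R -> probability T R) (X : R -> T -> R)
    (f delta : R -> R) (A : set R) : set R :=
  [set x | I x /\ (f x)%:E = J P X f delta x A].

Definition Theta (d : measure_display) (T : measurableType d)
    (R : realType) (I : set R) (P : R -> probability T R) (X : R -> T -> R)
    (f delta : R -> R) (A : set R) : set R :=
  stopping_region I P X f delta A `|`
  (indifference_region I P X f delta A `&` A).

(* As I is an interval, the Borel subsets of I are the Borel subsets of R
   contained in I. *)
Definition equilibrium (d : measure_display) (T : measurableType d)
    (R : realType) (I : set R) (P : R -> probability T R) (X : R -> T -> R)
    (f delta : R -> R) (A : set R) : Prop :=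
  [/\ measurable A, A `<=` I & Theta I P X f delta A = A].

(* Main.v *)
(* By (a), started in C the process returns to C immediately, so a closed C is an
   equilibrium exactly when f <= J(., C) on the state space, with equality on C.
   Let tau_1 be the first visit to A, tau_2 the first visit to B from tau_1 on,
   tau_3 the first visit to A from tau_2 on, and so on. Since f <= J(., A), J(., B), the
   strong Markov property and the log sub-additivity of delta show that
   E[delta(tau_n) f(X_{tau_n})] is nondecreasing in n, starting from J(x, A). By
   continuity of the paths tau_n increases to the first visit of A `&` B (or to
   +oo, where the discounted payoff vanishes by (b)), and dominated convergence,
   based on (c), gives J(x, A) <= J(x, A `&` B). *)
Require Import Defs.
From mathcomp Require Import all_boot all_order all_algebra.
From mathcomp Require Import all_classical all_reals all_analysis measurable_realfun.
From mathcomp Require Import giry.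
From mathcomp Require Import lra.
Import Order.TTheory GRing.Theory Num.Theory.
Import numFieldNormedType.Exports.

Set Implicit Arguments.
Unset Strict Implicit.
Unset Printing Implicit Defensive.

Local Open Scope classical_set_scope.
Local Open Scope ring_scope.

(** * First visits of continuous paths *)

Section real_functions.
Context {R : realType}.
Implicit Types (D C I : set R) (p : R -> R) (s t e : R).

(** Two obstacles shape the development. The strong Markov hypothesis concerns the product
    sigma-algebra on arbitrary functions, where a first visit to a closed set is in general not
    measurable. So [debut] is defined through rational times, which makes it measurable on all
    paths, and it is identified with the first visit on continuous paths only. Moreover, the
    hypothesis treats path events restricted to events of the past, whereas the step from tau_n to
    tau_(n+1) integrates delta(tau_n) times a functional of the future. Functionals are reached by
    comparing two measures on path space, and the weight by slicing it into levels: as delta is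
    monotone and continuous, the nonempty superlevel sets of delta(tau_n) at positive levels have
    the form {tau_n <= u}. Visits at the starting time count in [debut], so that on every path the
    chain rests once it is at a common point of A and B; assumption (a) makes this convention agree
    almost surely with [hitting_time], which only sees t > 0. *)

Lemma within_continuous_eps D p s e : {within D, continuous p} -> D s ->
  0 < e -> exists2 d : R, 0 < d & forall u, D u -> `|u - s| < d -> `|p u - p s| < e.
Proof.
move=> cp Ds e0.
have /cvgrPdist_lt /(_ _ e0) := cp s.
rewrite {1}/nbhs/= -nbhs_subspace_in// => -[d /= d0 H].
exists d => // u Du us; rewrite distrC; apply: H => //=.
by rewrite distrC.
Qed.

Lemma eps_within_continuous D p :
  (forall s, D s -> forall e, 0 < e ->
    exists2 d : R, 0 < d & forall u, D u -> `|u - s| < d -> `|p u - p s| < e) ->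
  {within D, continuous p}.
Proof.
move=> H; apply/subspace_continuousP => s Ds; apply/cvgrPdist_lt => e e0.
have [d d0 Hd] := H s Ds e e0.
by exists d => //= u /= us Du; rewrite distrC; apply: Hd => //; rewrite distrC.
Qed.

Lemma within_continuous_cvg D p (u : R^nat) s : {within D, continuous p} ->
  D s -> (forall n, D (u n)) -> u @ \oo --> s -> p \o u @ \oo --> p s.
Proof.
move=> cp Ds Du us; apply/cvgrPdist_lt => e e0.
have [d d0 Hd] := within_continuous_eps cp Ds e0.
move/cvgrPdist_lt: us => /(_ _ d0); apply: filterS => n /= usn.
by rewrite distrC; apply: Hd => //; rewrite distrC.
Qed.

Lemma closed_subspace_approx I C y : closed (C : set (subspace I)) -> I y ->
  (forall e, 0 < e -> exists2 c, C c & `|y - c| < e) -> C `<=` I -> C y.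
Proof.
move=> /closed_subspaceP[V cV VI] Iy H CI.
suff Vy : V y.
  have : (V `&` I) y by [].
  by rewrite VI => -[].
apply: cV => B /nbhs_ballP[e /= e0 eB].
have [c Cc yc] := H e e0; exists c; split; last exact: eB.
have : (C `&` I) c by split => //; exact: CI.
by rewrite -VI => -[].
Qed.

(** Staying in [0, t] even when s = t lets a visit by time t be approximated without looking past t;
    for t = 0 only q = 0 is left. *)
Lemma rat_near_le s t e : 0 <= s <= t -> 0 < e ->
  exists2 q : rat, 0 <= (ratr q : R) <= t & `|ratr q - s| < e.
Proof.
move=> /andP[s0 st] e0.
have [t0|t0] := leP t 0.
  have -> : s = 0 by apply/eqP; rewrite eq_le s0 (le_trans st).
  by exists 0; rewrite rmorph0 ?subrr ?normr0// lexx (le_trans s0).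
have : Num.max 0 (s - e) < Num.min t (s + e).
  by rewrite gt_max !lt_min; lra.
move=> /rat_in_itvoo[q]; rewrite in_itv/= gt_max lt_min => qb.
by exists q; [lra|rewrite ltr_distl; lra].
Qed.

(* For continuous I-valued paths p and C closed in I this says that p visits C
   during [a, r]; being expressed with countably many times, it is measurable
   for arbitrary paths and adapted to the right-continuous filtration. *)
Definition debut_approx C (a : \bar R) p r := forall k : nat, exists q : rat,
  [/\ 0 <= (ratr q : R) <= r, (a <= (ratr q + k.+1%:R^-1)%:E)%E &
     exists2 c, C c & `|p (ratr q) - c| < k.+1%:R^-1].

(* Unlike for [hitting_time], a visit at time a itself counts. *)
Definition debut C (a : \bar R) p : \bar R :=
  ereal_inf [set r%:E | r in [set r | 0 <= r /\ debut_approx C a p r] ].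

(** The paths on which [debut] is an actual first visit; its measurability is proved without this
    condition. *)
Definition state_path I p := {within `[0, +oo[, continuous p} /\ forall t, 0 <= t -> I (p t).

Lemma debut_approx_mono C a p r s : r <= s -> debut_approx C a p r -> debut_approx C a p s.
Proof.
move=> rs H k; have [q [q0 aq cq]] := H k; exists q; split=> //.
by move: q0 => /andP[-> /le_trans]; exact.
Qed.

(** The rational time is taken in [0, s], so it may fall before a when s is close to a; the slack
    1/(k+1) in [debut_approx] absorbs this. *)
Lemma debut_approx_hit I C a p s : state_path I p -> 0 <= s -> (a <= s%:E)%E -> C (p s) ->
  debut_approx C a p s.
Proof.
move=> [pc pI] s0 as_ Cps k.
have k0 : 0 < k.+1%:R^-1 :> R by rewrite invr_gt0.
have s0' : `[0, +oo[%classic s by rewrite /= in_itv/= s0.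
have [d d0 Hd] := within_continuous_eps pc s0' k0.
have ss : 0 <= s <= s by rewrite s0 lexx.
have e0 : 0 < Num.min d k.+1%:R^-1 by rewrite lt_min d0.
have [q qs] := rat_near_le ss e0; rewrite lt_min => /andP[qd qk].
exists q; split => //.
- by rewrite (le_trans as_)// lee_fin -lerBlDr ltW//; move: qk; rewrite ltr_distl => /andP[].
- by exists (p s) => //; apply: Hd => //=; rewrite in_itv/=; lra.
Qed.

Lemma debut_ge0 C a p : (0 <= debut C a p)%E.
Proof. by apply: le_ereal_inf_tmp => _ [r [r0 _] <-]; rewrite lee_fin. Qed.

Lemma debut_le I C a p s : state_path I p -> 0 <= s -> (a <= s%:E)%E -> C (p s) ->
  (debut C a p <= s%:E)%E.
Proof.
move=> pn s0 as_ Cps; apply: ereal_inf_lbound; exists s => //; split => //.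
exact: (debut_approx_hit pn s0 as_ Cps).
Qed.

(** No continuity is involved: [debut_approx] is monotone in its horizon, so the infimum can be
    tested at rationals. This countable form is the source of measurability. *)
Lemma debut_lt C a p s : (debut C a p < s%:E)%E <->
  exists q : rat, [/\ 0 <= (ratr q : R), ratr q < s & debut_approx C a p (ratr q)].
Proof.
split=> [/ereal_inf_lt[_ [r [r0 Hr] <-]]|[q [q0 qs Hq]]].
  rewrite lte_fin => /rat_in_itvoo[q]; rewrite in_itv/= => /andP[rq qs].
  by exists q; split; [lra| |exact: debut_approx_mono (ltW rq) Hr].
apply: (@le_lt_trans _ _ (ratr q)%:E); last by rewrite lte_fin.
by apply: ereal_inf_lbound; exists (ratr q).
Qed.

(** The infimum is attained by compactness: the approximate visits cluster at some s <= t,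
    continuity and relative closedness put p s in C, and [debut_le] at s then forces s = t. *)
Lemma debut_fin I C a p t : state_path I p -> closed (C : set (subspace I)) -> C `<=` I ->
  debut C a p = t%:E -> [/\ 0 <= t, (a <= t%:E)%E & C (p t)].
Proof.
move=> pn cC CI Dt.
have t0 : 0 <= t by rewrite -lee_fin -Dt debut_ge0.
have H k : exists q : rat, [/\ 0 <= (ratr q : R) <= t + k.+1%:R^-1,
    (a <= (ratr q + k.+1%:R^-1)%:E)%E &
    exists2 c, C c & `|p (ratr q) - c| < k.+1%:R^-1].
  (* The infimum is not yet known to be attained, hence the horizon t + 1/(k+1), which shrinks along
     with the tolerance. *)
  have /debut_lt[r [r0 rt]] : (debut C a p < (t + k.+1%:R^-1)%:E)%E.
    by rewrite Dt lte_fin ltrDl invr_gt0.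
  move=> /(_ k)[q [/andP[q0 qr] aq cq]]; exists q; split=> //.
  by rewrite q0 (le_trans qr)// ltW.
have [q Hq] := choice H.
pose u k : R := ratr (q k).
have u01 : forall k, `[0, t + 1]%classic (u k).
  move=> k; have [/andP[q0 qt] _ _] := Hq k; rewrite /= in_itv/= q0/=.
  by rewrite (le_trans qt)// lerD2l invf_le1// ler1n.
have [s [s0 clus]] : `[0, t + 1] `&` cluster (u @ \oo) !=set0.
  apply: (@segment_compact R 0 (t+1)).
  by exists 0%N => // k _; exact: u01.
have {}clus e : 0 < e -> forall N, exists2 k, (N <= k)%N & `|u k - s| < e.
  move=> e0 N.
  have [_ [[k Nk <-] /= sk]] := clus [set u k | k in [set k | (N <= k)%N]] (ball s e)
    (ltac:(by exists N => // k Nk; exists k)) (nbhsx_ballx s e e0).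
  by exists k => //; rewrite distrC.
have inv e : 0 < e -> exists N, forall k, (N <= k)%N -> k.+1%:R^-1 < e :> R.
  move=> e0; have [N _ HN] := near_infty_natSinv_lt (PosNum e0).
  by exists N => k Nk; exact: HN.
have approx e : 0 < e -> exists k, `|u k - s| < e /\ k.+1%:R^-1 < e :> R.
  move=> e0; have [N HN] := inv e e0; have [k Nk uk] := clus e e0 N.
  by exists k; split => //; exact: HN.
have {}s0 : 0 <= s by move: s0; rewrite /= in_itv/= => /andP[].
have st : s <= t.
  apply/ler_addgt0Pr => e e0; have e2 : 0 < e / 2 by lra.
  have [k [uk ke]] := approx _ e2; have [/andP[_ qt] _ _] := Hq k.
  by move: uk ke qt; rewrite ltr_distl -/(u k); move: (k.+1%:R^-1) => i ? ? ?; lra.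
have as_ : (a <= s%:E)%E.
  apply/lee_addgt0Pr => e e0; have e2 : 0 < e / 2 by lra.
  have [k [uk ke]] := approx _ e2; have [_ aq _] := Hq k.
  rewrite (le_trans aq)// -EFinD lee_fin.
  by move: uk ke; rewrite ltr_distl -/(u k); move: (k.+1%:R^-1) => i ? ?; lra.
have Cs : C (p s).
  apply: (closed_subspace_approx cC) => //; first exact: pn.2.
  move=> e e0; have e2 : 0 < e / 2 by lra.
  have s0' : `[0, +oo[%classic s by rewrite /= in_itv/= s0.
  have [d d0 Hd] := within_continuous_eps pn.1 s0' e2.
  have m0 : 0 < Num.min d (e / 2) by rewrite lt_min d0.
  have [k []] := approx _ m0; rewrite !lt_min => /andP[ud _] /andP[_ ke].
  have [/andP[q0 _] _ [c Cc pc]] := Hq k; exists c => //.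
  have := Hd (u k); rewrite /= in_itv/= q0 => /(_ isT ud).
  move: pc; rewrite -/(u k) => pc pus.
  rewrite -(subrK (p (u k)) (p s)) -addrA (le_lt_trans (ler_normD _ _))//.
  by rewrite distrC; move: pus pc ke; move: (k.+1%:R^-1) => i ? ? ?; lra.
have : (debut C a p <= s%:E)%E by exact: debut_le pn s0 as_ Cs.
rewrite Dt lee_fin => ts; suff -> : t = s by [].
by apply/eqP; rewrite eq_le ts.
Qed.

End real_functions.

(** * Measurability of first visits and of evaluations at random times *)

Section measurability_lemmas.
Context {R : realType}.

Lemma measurable_truncn_eq (j : nat) : measurable [set x : R | Num.truncn x = j].
Proof.
have H n : measurable [set x : R | (Num.truncn x <= n)%N].
  rewrite (_ : [set _ | _] = `]-oo, n.+1%:R[%classic)//.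
  by apply/seteqP; split => x /=; rewrite in_itv/= truncn_le_nat.
case: j => [|j].
  rewrite (_ : [set _ | _] = [set x : R | (Num.truncn x <= 0)%N])//.
  by apply/seteqP; split => x /=; rewrite leqn0 => /eqP.
rewrite (_ : [set _ | _] = [set x : R | (Num.truncn x <= j.+1)%N] `\`
  [set x : R | (Num.truncn x <= j)%N]); first exact: measurableD.
apply/seteqP; split => x /= => [->|[h /negP]]; first by rewrite ltnn.
by rewrite -ltnNge => h'; apply/eqP; rewrite eqn_leq h h'.
Qed.

(** For s >= 0 this rounds down to a multiple of 1/(n+1). Having countably many values, it allows
    evaluation of a process at a random time without continuity. *)
Definition grid (n : nat) (s : R) : R := (Num.truncn (n.+1%:R * s))%:R / n.+1%:R.

Lemma grid_ge0 n s : 0 <= grid n s.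
Proof. by rewrite /grid divr_ge0. Qed.

Lemma grid_cvg s : 0 <= s -> (grid ^~ s) @ \oo --> s.
Proof.
move=> s0; apply/cvgrPdist_lt => e e0.
near=> n.
have n0 : (0 : R) < n.+1%:R by [].
rewrite distrC /grid.
have /truncn_itv /andP[h1 h2] : 0 <= n.+1%:R * s by rewrite mulr_ge0.
have ne : (n.+1%:R)^-1 < e.
  near: n; exact: (near_infty_natSinv_lt (PosNum e0)).
apply: le_lt_trans ne.
have -> : (Num.truncn (n.+1%:R * s))%:R / n.+1%:R - s =
    ((Num.truncn (n.+1%:R * s))%:R - n.+1%:R * s) / n.+1%:R.
  by rewrite mulrBl [n.+1%:R * s]mulrC mulfK ?gt_eqF.
rewrite normrM [X in _ * X]gtr0_norm ?invr_gt0// ler_piMl ?invr_ge0//.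
by rewrite ler_norml; move: h1 h2; rewrite -natr1; move: (_ * s) => x; lra.
Unshelve. all: by end_near. Qed.

Section eval.
Context d (S : measurableType d).
Implicit Types (Z : R -> S -> R) (C : set R).

Lemma measurable_eval_grid d' (U : measurableType d') (Z : R -> S -> U)
    (sigma : S -> R) n : measurable_fun setT sigma ->
  (forall t, 0 <= t -> measurable_fun setT (Z t)) ->
  measurable_fun setT (fun w => Z (grid n (sigma w)) w).
Proof.
move=> msg mZ _ B mB; rewrite setTI.
rewrite (_ : _ @^-1` _ = \bigcup_j
  ((fun w => n.+1%:R * sigma w) @^-1` [set x | Num.truncn x = j] `&`
    (Z (j%:R / n.+1%:R)) @^-1` B)).
  apply: bigcupT_measurable => j; apply: measurableI.
    rewrite -[X in measurable X]setTI; apply: measurable_funM => //.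
    exact: measurable_truncn_eq.
  by rewrite -[X in measurable X]setTI; apply: mZ.
apply/seteqP; split => w /=.
  by move=> Bw; exists (Num.truncn (n.+1%:R * sigma w)).
by move=> [j _ [/= <-]].
Qed.

Lemma measurable_eval Z (sigma : S -> R) : measurable_fun setT sigma ->
  (forall w, 0 <= sigma w) ->
  (forall t, 0 <= t -> measurable_fun setT (Z t)) ->
  (forall w, {within `[0, +oo[, continuous (Z ^~ w)}) ->
  measurable_fun setT (fun w => Z (sigma w) w).
Proof.
move=> msg s0 mZ cZ.
apply: (measurable_fun_cvg (fun n => measurable_eval_grid n msg mZ)) => w _.
apply: (within_continuous_cvg (cZ w)); first by rewrite /= in_itv/= s0.
  by move=> n; rewrite /= in_itv/= grid_ge0.
exact: grid_cvg.
Qed.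

Lemma measurable_fin_time (tau : S -> \bar R) : measurable_fun setT tau ->
  measurable_fun setT (fun w => (tau w < +oo)%E).
Proof.
move=> mtau; apply: (measurable_fun_bool true); rewrite setTI.
suff -> : (fun w => (tau w < +oo)%E) @^-1` [set true] = [set w | (tau w < +oo)%E].
  by rewrite -[X in measurable X]setTI; exact: emeasurable_fun_infty_o.
by apply/seteqP; split.
Qed.

(** C may be any set: the union of the balls around its points is open, hence Borel. *)
Lemma measurable_near C (e : R) (g : S -> R) : measurable_fun setT g ->
  measurable [set w | exists2 c, C c & `|g w - c| < e].
Proof.
move=> mg; rewrite (_ : [set w | _] = g @^-1` (\bigcup_(c in C) ball c e)).
  rewrite -[X in measurable X]setTI; apply: mg => //.
  by apply: open_measurable; apply: bigcup_open => c _; exact: ball_open.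
apply/seteqP; split => w /= [c Cc h]; exists c => //.
  by rewrite /ball/= distrC.
by move: h; rewrite /ball/= distrC.
Qed.

(** Only times before s enter the hypotheses. Read over the full sigma-algebra this yields
    measurability, over the one generated up to time s it yields adaptedness. *)
Lemma measurable_debut_lt Z C (a : S -> \bar R) (s : R) :
  (forall t, 0 <= t < s -> measurable_fun setT (Z t)) ->
  (forall t, 0 <= t < s -> measurable [set w | (a w <= t%:E)%E]) ->
  measurable [set w | (debut C (a w) (Z ^~ w) < s%:E)%E].
Proof.
move=> mZ ma.
rewrite (_ : [set w | _] = \bigcup_(q in [set q : rat | 0 <= (ratr q : R) < s])
   [set w | debut_approx C (a w) (Z ^~ w) (ratr q)]); last first.
  apply/seteqP; split => w /=; rewrite debut_lt.
    by move=> [q [q0 qs H]]; exists q => //=; rewrite q0.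
  by move=> [q /andP[q0 qs] H]; exists q.
rewrite bigcup_mkcond; apply: bigcupT_measurable_rat => r.
case: ifPn => //; rewrite inE/= => /andP[r0 rs].
have [K HK] : exists K : nat, forall k, (K <= k)%N -> ratr r + k.+1%:R^-1 < s.
  have e0 : 0 < s - ratr r by rewrite subr_gt0.
  have [K _ HK] := near_infty_natSinv_lt (PosNum e0).
  by exists K => k Kk; rewrite -ltrBrDl; exact: HK.
(* Discarding the indices k < K keeps all the times involved below s. *)
rewrite (_ : [set w | _] = \bigcap_(k in [set k | (K <= k)%N])
   \bigcup_(q in [set q : rat | 0 <= (ratr q : R) <= ratr r])
   ([set w | (a w <= (ratr q + k.+1%:R^-1)%:E)%E] `&`
    [set w | exists2 c, C c & `|Z (ratr q) w - c| < k.+1%:R^-1])).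
  apply: bigcap_measurable; first by exists K => /=.
  move=> k /= Kk; rewrite bigcup_mkcond; apply: bigcupT_measurable_rat => q.
  case: ifPn => //; rewrite inE/= => /andP[q0 qr]; apply: measurableI.
    apply: ma; rewrite addr_ge0//=.
    by rewrite (le_lt_trans _ (HK _ Kk))// lerD2r.
  by apply/measurable_near/mZ; rewrite q0 (le_lt_trans qr).
apply/seteqP; split => w /= H.
  by move=> k _; have [q [qr aq cq]] := H k; exists q.
(* The condition at the larger index [maxn K k] has the smaller tolerance, so it implies the one at
   k. *)
move=> k; have [|q qr [/= aq [c Cc zq]]] := H (maxn K k) => /=.
  by rewrite leq_maxl.
have kk : (maxn K k).+1%:R^-1 <= k.+1%:R^-1 :> R.
  by rewrite lef_pV2 ?posrE// ler_nat ltnS leq_maxr.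
exists q; split => //.
  by rewrite (le_trans aq)// lee_fin lerD2l.
by exists c => //; exact: lt_le_trans zq kk.
Qed.

Lemma measurable_debut Z C (a : S -> \bar R) :
  (forall t, 0 <= t -> measurable_fun setT (Z t)) ->
  measurable_fun setT a ->
  measurable_fun setT (fun w => debut C (a w) (Z ^~ w)).
Proof.
move=> mZ ma.
apply: (measurability _ (ErealGenInftyO.measurableE R)) => _ [_ [s ->] <-].
rewrite setTI (_ : _ @^-1` _ = [set w | (debut C (a w) (Z ^~ w) < s%:E)%E]).
  apply: measurable_debut_lt => t /andP[t0 _]; first exact: mZ.
  by rewrite -[X in measurable X]setTI; exact: emeasurable_fun_infty_c.
by apply/seteqP; split => w /=; rewrite in_itv.
Qed.

End eval.
End measurability_lemmas.

(** * Stopping times and the strong Markov property for functionals *)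

Section stopping.
Context d (T : measurableType d) (R : realType) (X : R -> T -> R).
Local Notation F := (right_limit_filtration (natural_filtration X)).

Let gens (t : R) : set (set T) := [set A | exists (s : R) (B : set R),
  [/\ 0 <= s <= t, measurable B & A = X s @^-1` B] ].

Lemma right_limit_filtration_le s t : s <= t -> F s `<=` F t.
Proof. by move=> st A FA u tu; apply: FA; exact: le_lt_trans st tu. Qed.

Lemma natural_filtration_sub t : (forall s, 0 <= s -> measurable_fun setT (X s)) ->
  natural_filtration X t `<=` measurable.
Proof.
move=> mX; apply: smallest_sub; first exact: sigma_algebra_measurable.
move=> A [s [B [/andP[s0 _] mB ->]]].
by rewrite -[X in measurable X]setTI; exact: mX.
Qed.

(** The event {debut <= t} is the intersection of {debut < t + 1/(k+1)}, which looks just beyond t;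
    this is where the right-limit filtration is needed. *)
Lemma stopping_time_debut C tau : stopping_time F tau ->
  stopping_time F (fun w => debut C (tau w) (X ^~ w)).
Proof.
move=> [tau0 Ftau]; split; first by move=> w; exact: debut_ge0.
move=> t t0 s ts.
(* With the past up to s as the sigma-algebra of [S], adaptedness becomes plain measurability. *)
pose S := g_sigma_algebraType (gens s).
suff : measurable ([set w | (debut C (tau w) (X ^~ w) <= t%:E)%E] : set S) by [].
have [K HK] : exists K : nat, forall k, (K <= k)%N -> t + k.+1%:R^-1 < s.
  have e0 : 0 < s - t by rewrite subr_gt0.
  have [K _ HK] := near_infty_natSinv_lt (PosNum e0).
  by exists K => k Kk; rewrite -ltrBrDl; exact: HK.
rewrite (_ : [set w | _] = \bigcap_(k in [set k | (K <= k)%N])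
   [set w : S | (debut C (tau w) (X ^~ w) < (t + k.+1%:R^-1)%:E)%E]); last first.
  apply/seteqP; split => w /= H.
    by move=> k _; apply: le_lt_trans H _; rewrite lte_fin ltrDl invr_gt0.
  apply/lee_addgt0Pr => e e0.
  have [N _ HN] := near_infty_natSinv_lt (PosNum e0).
  have /ltW/le_trans := H (maxn K N) (leq_maxl _ _); apply.
  rewrite -EFinD lee_fin lerD2l; apply: ltW; apply: HN => /=.
  by rewrite leq_maxr.
apply: bigcap_measurable; first by exists K => /=.
move=> k Kk; apply: (@measurable_debut_lt R _ S) => u /andP[u0 us].
  move=> _ B mB; rewrite setTI; apply: sub_sigma_algebra; exists u, B; split => //.
  by rewrite u0 ltW// (lt_trans us)// HK.
by apply: Ftau => //; rewrite (lt_trans us)// HK.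
Qed.

Lemma stopping_time_cst0 : (forall s, 0 <= s -> measurable_fun setT (X s)) ->
  stopping_time F (fun=> 0%:E).
Proof.
move=> mX; split=> // t t0 s ts; rewrite (_ : [set _ | _] = setT).
  exact: (@measurableT _ (g_sigma_algebraType (gens s))).
by apply/seteqP; split => w //= _; rewrite lee_fin.
Qed.

Lemma stopping_time_measurable tau :
  (forall s, 0 <= s -> measurable_fun setT (X s)) ->
  stopping_time F tau -> measurable_fun setT tau.
Proof.
move=> mX [tau0 Ftau].
apply: (measurability _ (ErealGenOInfty.measurableE R)) => _ [_ [s ->] <-].
rewrite setTI -[X in measurable X]setCK; apply: measurableC.
have [s0|s0] := leP 0 s; last first.
  rewrite (_ : ~` _ = set0)//; apply/seteqP; split => w //=.
  by apply; rewrite in_itv/= andbT (lt_le_trans _ (tau0 w)).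
rewrite (_ : ~` _ = [set w | (tau w <= s%:E)%E]).
  by apply: (natural_filtration_sub mX (t := s + 1)); apply: Ftau => //; rewrite ltrDl.
apply/seteqP; split => w /=; rewrite in_itv/= andbT.
  by move/negP; rewrite -leNgt.
by rewrite leNgt => /negP.
Qed.

(** These are the past events to which the strong Markov property is applied: they are the levels of
    the discount at tau. *)
Lemma stopped_le tau t : (forall s, 0 <= s -> measurable_fun setT (X s)) ->
  stopping_time F tau -> 0 <= t ->
  stopped_sigma_algebra F tau [set w | (tau w <= t%:E)%E].
Proof.
move=> mX st t0; split.
  rewrite -[X in measurable X]setTI; apply: emeasurable_fun_infty_c => //.
  exact: stopping_time_measurable.
move=> s s0; rewrite (_ : _ `&` _ = [set w | (tau w <= (Num.min t s)%:E)%E]).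
  apply: (@right_limit_filtration_le (Num.min t s)).
    by rewrite ge_min lexx orbT.
  by apply: st.2; rewrite le_min t0.
by apply/seteqP; split => w /=; rewrite EFin_min le_min => /andP.
Qed.

End stopping.

Section path_space.
Context {R : realType}.

Definition path_space := g_sigma_algebraType
  [set C | exists (t : R) (B : set R),
    [/\ 0 <= t, measurable B & C = [set p : R -> R | B (p t)]] ].

Lemma measurable_coord t : 0 <= t -> measurable_fun setT (fun p : path_space => p t).
Proof.
by move=> t0 _ B mB; rewrite setTI; apply: sub_sigma_algebra; exists t, B.
Qed.

Lemma measurable_path d (S : measurableType d) (Y : S -> path_space) :
  (forall t, 0 <= t -> measurable_fun setT (fun w => Y w t)) -> measurable_fun setT Y.
Proof.
move=> mY; apply: (@measurability _ _ S (path_space) setT Y _ (erefl _)) => _ [_ [t [B [t0 mB ->]]] <-].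
by rewrite setTI -[X in measurable X]setTI; exact: mY.
Qed.

End path_space.
Arguments path_space R : clear implicits.

Section strong_markov_functional.
Context d (T : measurableType d) (R : realType) (I : set R)
  (P : R -> probability T R) (X : R -> T -> R).
Context (hI : is_interval I) (hX : strong_markov_process I P X).
Local Notation F := (right_limit_filtration (natural_filtration X)).

Definition traj (w : T) : path_space R := X ^~ w.

Lemma measurable_traj : measurable_fun setT traj.
Proof. by apply: measurable_path => t t0; exact: smp_measurable hX t t0. Qed.

Definition law (y : R) : giry (path_space R) R :=
  giry_map measurable_traj (P y : giry T R).

(** Measurability into the Giry space is tested on each path event, where it is [smp_kernel]; that
    field speaks of [I] only, hence the condition on y. *)
Lemma measurable_law (y : T -> R) : measurable_fun setT y ->
  (forall w, I (y w)) -> measurable_fun setT (fun w => law (y w)).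
Proof.
move=> my Iy; apply: measurable_giry_codensity => // B mB.
apply: (@measurable_comp _ _ _ _ _ _ I (fun x => P x [set w | B (X ^~ w)])) => //.
- exact: is_interval_measurable.
- by move=> _ [w _ <-].
- exact: smp_kernel hX _ mB.
Qed.

Lemma strong_markov_functional x tau G (V : path_space R -> \bar R) : I x ->
  stopping_time F tau -> stopped_sigma_algebra F tau G ->
  G `<=` [set w | (tau w < +oo)%E] ->
  measurable_fun setT V -> (forall p, 0 <= V p)%E ->
  (\int[P x]_(w in G) V (fun t => X (fine (tau w) + t)%R w) =
   \int[P x]_(w in G) \int[P (X (fine (tau w)) w)]_w' V (X ^~ w'))%E.
Proof.
move=> Ix st sG Gfin mV V0.
have mX := smp_measurable hX.
have mG : measurable G := sG.1.
have mtau : measurable_fun setT (fine \o tau).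
  by apply: measurableT_comp => //; exact: stopping_time_measurable st.
have tau0 w : 0 <= fine (tau w) by rewrite fine_ge0// st.1.
have mXt t : 0 <= t -> measurable_fun setT (fun w => X (fine (tau w) + t) w).
  move=> t0; apply: (measurable_eval (sigma := fun w => fine (tau w) + t)).
  - exact: measurable_funD.
  - by move=> w; rewrite addr_ge0.
  - by move=> s s0; exact: mX.
  - exact: smp_continuous hX.
pose Y (w : T) : path_space R := fun t => X (fine (tau w) + t)%R w.
have mY : measurable_fun setT Y by exact: measurable_path.
pose y w := X (fine (tau w)) w.
have my : measurable_fun setT y.
  by have := mXt 0 (lexx 0); under eq_fun do rewrite addr0.
have Iy w : I (y w) by apply: smp_state hX _ _ _.
have mGb : measurable_fun setT (fun w => w \in G).
  apply: (measurable_fun_bool true); rewrite setTI.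
  suff -> : (fun w => w \in G) @^-1` [set true] = G by [].
  by apply/seteqP; split => w /=; [move=> /set_mem|move=> /mem_set].
(* Both sides are integrals of V against the mixtures over P x of the
   sub-probability kernels k1 and k2, which agree by the strong Markov
   property. *)
pose k1 (w : T) : giry (path_space R) R := if w \in G then giry_ret (Y w) else mzero.
pose k2 (w : T) : giry (path_space R) R := if w \in G then law (y w) else mzero.
have mk1 : measurable_fun setT k1.
  apply: measurable_fun_ifT => //.
  by apply: (measurableT_comp _ mY); exact: measurable_giry_ret.
have mk2 : measurable_fun setT k2.
  by apply: measurable_fun_ifT => //; exact: measurable_law.
have bindE k (mk : measurable_fun setT k) B : measurable B ->
   giry_bind (P x : giry T R) mk B = (\int[P x]_w k w B)%E.
  move=> mB; rewrite /giry_bind/= /giry_join/= giry_int_map//.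
  exact: measurable_giry_ev.
have intE (k : T -> giry (path_space R) R) (g : T -> giry (path_space R) R)
    (h : path_space R -> \bar R) :
    (forall w, k w = if w \in G then g w else mzero) ->
    (\int[P x]_w \int[k w]_p h p = \int[P x]_(w in G) \int[g w]_p h p)%E.
  move=> kE; rewrite [RHS]integral_mkcond; apply: eq_integral => w _.
  by rewrite patchE kE; case: ifPn => // _; exact: integral_measure_zero.
(* Both sides equal the probability of G and {Y in B}: the first as the integral of an indicator,
   the second by [smp_strong_markov]. *)
have E B : measurable B -> giry_bind (P x : giry T R) mk1 B = giry_bind (P x : giry T R) mk2 B.
  move=> mB; rewrite !bindE//.
  transitivity (P x (G `&` [set w | B (Y w)])).
    rewrite -[G `&` _]setIT -integral_indic//; last first.
      by apply: measurableI => //; rewrite -[X in measurable X]setTI; exact: mY.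
    apply: eq_integral => w _; rewrite /k1 indicE in_setI.
    by case: ifPn => wG //=; rewrite /giry_ret /dirac/= indicE.
  rewrite (smp_strong_markov hX Ix st sG Gfin mB) integral_mkcond.
  by apply: eq_integral => w _; rewrite patchE /k2; case: ifPn.
have := @eq_measure_integral _ _ R setT _ (giry_bind (P x : giry T R) mk1) V (fun B mB _ => E B mB).
rewrite -[LHS]/(giry_int _ _) -[RHS]/(giry_int _ _) !giry_int_bind//.
rewrite /giry_int (intE _ (fun w => giry_ret (Y w)))// (intE _ (fun w => law (y w)))//.
have -> : (\int[P x]_(w in G) \int[giry_ret (Y w)]_p V p =
           \int[P x]_(w in G) V (Y w))%E.
  by apply: eq_integral => w _; exact: giry_int_ret.
move=> ->; apply: eq_integral => w _.
by rewrite -[LHS]/(giry_int (law (y w)) V) giry_int_map.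
Qed.

End strong_markov_functional.

(** * Layer cake formula *)

Section layer_cake.
Local Open Scope ereal_scope.
Context d (T : measurableType d) (R : realType).
Context (mu : {finite_measure set T -> \bar R}).
Context (h : T -> R) (mh : measurable_fun setT h) (h0 : forall w, (0 <= h w)%R).

Let lay (g : T -> \bar R) (z : T * measurableTypeR R) : \bar R :=
  (\1_[set z : T * measurableTypeR R | (0 < z.2 <= h z.1)%R] z)%:E * g z.1.

Let mset : measurable [set z : T * measurableTypeR R | (0 < z.2 <= h z.1)%R].
Proof.
have mb : measurable_fun setT (fun z : T * measurableTypeR R => (0 < z.2 <= h z.1)%R).
  apply: measurable_and.
    by apply: measurable_fun_ltr => //; exact: measurable_snd.
  apply: measurable_fun_ler; first exact: measurable_snd.
  exact: measurableT_comp measurable_fst.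
by have := mb measurableT [set true] I; rewrite setTI.
Qed.

(** Write h w as the Lebesgue measure of []0, h w]] and apply Tonelli. Leaving out the level r = 0
    matters: {0 <= h} would also contain the points where tau is infinite. *)
Lemma layer_cake (g : T -> \bar R) : measurable_fun setT g -> (forall w, 0 <= g w) ->
  \int[mu]_w ((h w)%:E * g w) =
  \int[lebesgue_measure]_(r in `]0%R, +oo[) \int[mu]_(w in [set w | (r <= h w)%R]) g w.
Proof.
move=> mg g0.
have mlay : measurable_fun setT (lay g).
  apply: emeasurable_funM; last exact: measurableT_comp measurable_fst.
  by apply/measurable_EFinP; exact: measurable_indic.
have lay0 z : 0 <= lay g z by rewrite mule_ge0// lee_fin.
transitivity (\int[mu]_w \int[lebesgue_measure]_r lay g (w, r)).
  apply: eq_integral => w _.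
  have sec : ([set z | (0 < z.2 <= h z.1)%R] : set (T * measurableTypeR R)) =
    [set z | `]0%R, h z.1]%classic z.2].
    by apply/seteqP; split => z /=; rewrite in_itv.
  have indE r : (\1_([set z | (0 < z.2 <= h z.1)%R] : set (T * measurableTypeR R)) (w, r) : R) =
      \1_(`]0%R, h w]%classic) r.
    by rewrite sec !indicE; congr (nat_of_bool _)%:R; apply/idP/idP; rewrite !inE.
  transitivity (\int[lebesgue_measure]_(r in [set: measurableTypeR R])
      (g w * (\1_(`]0%R, h w]%classic) r)%:E)); last first.
    by apply: eq_integral => r _; rewrite /lay indE muleC.
  rewrite ge0_integralZl//; last first.
    by apply/measurable_EFinP; exact: measurable_indic.
  rewrite muleC integral_indic// setIT; congr (_ * _).
  have -> : (h w)%:E = lebesgue_measure `]0%R, h w]%classic; last by [].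
  rewrite lebesgue_measure_itv/= lte_fin.
  have [hw|hw] := ltP 0%R (h w); first by rewrite sube0.
  by congr (_ %:E); apply/eqP; rewrite eq_le hw h0.
rewrite fubini_tonelli// [RHS]integral_mkcond; apply: eq_integral => r _.
rewrite patchE mem_setE in_itv/= andbT; case: ifPn => r0; last first.
  apply: integral0_eq => w _; rewrite /lay indicE memNset ?mul0e//=.
  by rewrite (negbTE r0).
rewrite [RHS]integral_mkcond; apply: eq_integral => w _.
rewrite patchE /lay indicE; case: ifPn => hw.
  by rewrite mem_set ?mul1e//= r0; move: hw; rewrite inE.
by rewrite memNset ?mul0e//= r0/= => hw'; move/negP: hw; apply; rewrite inE.
Qed.

End layer_cake.


Lemma eq_integral_weight d (T : measurableType d) (R : realType)
    (mu : {finite_measure set T -> \bar R}) (h : T -> R) (g1 g2 : T -> \bar R) :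
  measurable_fun setT h -> (forall w, 0 <= h w) ->
  measurable_fun setT g1 -> (forall w, 0 <= g1 w)%E ->
  measurable_fun setT g2 -> (forall w, 0 <= g2 w)%E ->
  (forall r : R, (0 < r)%R -> \int[mu]_(w in [set w | (r <= h w)%R]) g1 w =
                      \int[mu]_(w in [set w | (r <= h w)%R]) g2 w)%E ->
  (\int[mu]_w ((h w)%:E * g1 w) = \int[mu]_w ((h w)%:E * g2 w))%E.
Proof.
move=> mh h0 mg1 g10 mg2 g20 eg; rewrite !layer_cake//.
by apply: eq_integral => r; rewrite inE/= in_itv/= andbT => /eg.
Qed.

(** * Discounted payoffs *)

Section discount.
Context {R : realType} (delta : R -> R) (hd : discount_function delta).

Lemma discount_ge0 t : 0 <= t -> 0 <= delta t.
Proof. by move=> /(discount_range hd)/andP[/ltW]. Qed.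

Lemma discount_le1 t : 0 <= t -> delta t <= 1.
Proof. by move=> /(discount_range hd)/andP[]. Qed.

Lemma discountD s t : 0 <= s -> 0 <= t -> delta s * delta t <= delta (s + t).
Proof.
rewrite le_eqVlt => /predU1P[<-|s0]; first by rewrite (discount0 hd) mul1r add0r.
rewrite le_eqVlt => /predU1P[<-|t0]; first by rewrite (discount0 hd) mulr1 addr0.
exact: (discount_log_subadditive hd).
Qed.

(** The superlevel set is an initial interval by monotonicity, bounded as delta tends to 0, and
    contains its supremum u by continuity; it is empty when r > 1. *)
Lemma discount_level r : 0 < r -> (forall t, 0 <= t -> delta t < r) \/
  exists2 u, 0 <= u & forall t, 0 <= t -> (r <= delta t) = (t <= u).
Proof.
move=> r0; have [r1|r1] := ltP 1 r.
  by left => t t0; rewrite (le_lt_trans (discount_le1 t0)).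
right; pose S := [set t | 0 <= t /\ r <= delta t].
have S0 : S 0 by split; rewrite ?(discount0 hd).
have [M HM] : exists M, forall t, M < t -> delta t < r.
  have /cvgrPdist_lt /(_ _ r0)[M [_ HM]] := discount_cvg0 hd.
  exists M => t /HM/=; rewrite sub0r normrN; apply: le_lt_trans; exact: ler_norm.
have supS : has_sup S.
  split; first by exists 0.
  by exists M => t [_]; rewrite leNgt => rt; rewrite leNgt; apply: contra rt; exact: HM.
have u0 : 0 <= sup S by exact: ub_le_sup supS.2 _ S0.
exists (sup S) => // t t0; apply/idP/idP => [rt|tu]; first by apply: ub_le_sup => //; case: supS.
rewrite leNgt; apply/negP => tr.
(* If delta t < r with t <= sup S, take s in S beyond sup S - e: for s <= t continuity at t gives
   delta s < r, for s > t monotonicity does. *)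
have e0 : 0 < r - delta t by rewrite subr_gt0.
have t0' : `[0, +oo[%classic t by rewrite /= in_itv/= t0.
have [e ep He] := within_continuous_eps (discount_continuous hd) t0' e0.
have [s [s0 rs] es] := sup_adherent ep supS.
have [st|ts] := leP s t.
  have : `|delta s - delta t| < r - delta t.
    by apply: He; rewrite /= ?in_itv/= ?s0// ltr_distl; lra.
  by rewrite ltr_distl; lra.
by have := discount_nonincreasing hd t0 (ltW ts); lra.
Qed.

End discount.

Section payoff.
Context {R : realType} (I : set R) (f delta : R -> R).
Context (hI : is_interval I) (f0 : forall x, I x -> 0 <= f x)
  (cf : {within I, continuous f}) (hd : discount_function delta).
Implicit Types (p : R -> R) (C : set R).

(** The value 0 at [+oo] stands for the limsup, which vanishes almost surely by (b). *)
Definition payoff_at (theta : \bar R) p : R :=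
  if theta is t%:E then delta t * f (p t) else 0.

Lemma payoff_at_ge0 theta p : state_path I p -> (0 <= theta)%E -> 0 <= payoff_at theta p.
Proof.
move=> [_ pI]; case: theta => //= t; rewrite lee_fin => t0.
by rewrite mulr_ge0 ?(discount_ge0 hd)// f0//; exact: pI.
Qed.

Lemma state_path_shift p t : state_path I p -> 0 <= t -> state_path I (fun u => p (t + u)).
Proof.
move=> [pc pI] t0; split; last by move=> u u0; apply: pI; rewrite addr_ge0.
apply: eps_within_continuous => s; rewrite /= in_itv/= andbT => s0 e e0.
have ts0 : `[0, +oo[%classic (t + s) by rewrite /= in_itv/= andbT addr_ge0.
have [d' d0 Hd] := within_continuous_eps pc ts0 e0.
exists d' => // u; rewrite /= in_itv/= andbT => u0 us.
apply: Hd; first by rewrite /= in_itv/= andbT addr_ge0.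
by rewrite opprD addrACA subrr add0r.
Qed.

(** Rational times are not invariant under a real shift, so the two sides are compared through the
    attained visits, each carried to the other time scale. *)
Lemma debut_shift C p t s : state_path I p -> closed (C : set (subspace I)) -> C `<=` I ->
  0 <= t -> debut C 0%:E (fun u => p (t + u)) = s%:E -> debut C t%:E p = (t + s)%:E.
Proof.
move=> pn cC CI t0 Ds; have [s0 _ Cs] := debut_fin (state_path_shift pn t0) cC CI Ds.
have ts : (debut C t%:E p <= (t + s)%:E)%E.
  by apply: (debut_le pn _ _ Cs); rewrite ?lee_fin ?lerDl ?addr_ge0.
have := debut_ge0 C t%:E p; case Dv : (debut C t%:E p) ts => [v| |]//.
rewrite !lee_fin => vts v0.
have [_ + Cv] := debut_fin pn cC CI Dv; rewrite lee_fin => tv.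
congr _%:E; apply/eqP; rewrite eq_le vts/= -lerBrDl -lee_fin -Ds.
apply: debut_le (state_path_shift pn t0) _ _ _; rewrite ?lee_fin ?subr_ge0//.
by rewrite addrC subrK.
Qed.

(** Continuity of f and delta is known on their domains only; extended by 0 they are Borel on R and
    nonnegative. *)
Let f' := f \_ I.
Let delta' := delta \_ `[0, +oo[.

Lemma measurable_payoff_fun : measurable_fun setT f'.
Proof.
have mI := is_interval_measurable hI.
by apply/(measurable_restrictT _ mI); exact: subspace_continuous_measurable_fun.
Qed.

Lemma measurable_discount_fun : measurable_fun setT delta'.
Proof.
apply/(measurable_restrictT _ (measurable_itv `[0, +oo[)).
apply: subspace_continuous_measurable_fun => //; exact: (discount_continuous hd).
Qed.

(* [payoff_at (debut C 0 p) p] made measurable on all paths: the evaluation of p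
   at a random time is replaced by a limit along discretized times. *)
Definition path_payoff C (p : path_space R) : \bar R :=
  limn_esup (fun n => (if (debut C 0%:E p < +oo)%E then
    delta' (fine (debut C 0%:E p)) * f' (p (grid n (fine (debut C 0%:E p))))
    else 0)%:E).

Let f'_ge0 x : 0 <= f' x.
Proof. by rewrite /f' patchE; case: ifPn => // /set_mem; exact: f0. Qed.

Let delta'_ge0 x : 0 <= delta' x.
Proof.
by rewrite /delta' patchE; case: ifPn => //; rewrite inE/= in_itv/= andbT => /(discount_ge0 hd).
Qed.

Lemma path_payoff_ge0 C p : (0 <= path_payoff C p)%E.
Proof.
apply: limf_esup_ge0 => // n; case: ifPn => // _; rewrite lee_fin.
exact: mulr_ge0.
Qed.

(** Along a continuous path the grid times converge to the visit, so the limsup is a limit. *)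
Lemma path_payoffE C p : state_path I p -> path_payoff C p = (payoff_at (debut C 0%:E p) p)%:E.
Proof.
move=> pn; have := debut_ge0 C 0%:E p; rewrite /path_payoff /payoff_at.
case: (debut C 0%:E p) => [t| |]// => [|_]; last first.
  by apply: (cvg_limn_einf_sup _).2; rewrite ltxx; exact: cvg_cst.
rewrite lee_fin => t0; apply: (cvg_limn_einf_sup _).2; rewrite ltry/=.
apply: cvg_EFin; first by apply: nearW.
rewrite /delta' patchE mem_set/= ?in_itv/= ?t0//.
apply: cvgM; first exact: cvg_cst.
have -> : (fun n => f' (p (grid n t))) = f \o (fun n => p (grid n t)).
  by apply/funext => n /=; rewrite /f' patchE mem_set//; apply: pn.2; exact: grid_ge0.
apply: (within_continuous_cvg cf); first exact: pn.2.
  by move=> n; apply: pn.2; exact: grid_ge0.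
apply: (within_continuous_cvg pn.1); first by rewrite /= in_itv/= t0.
  by move=> n; rewrite /= in_itv/= grid_ge0.
exact: grid_cvg.
Qed.

Lemma measurable_path_payoff C : measurable_fun setT (path_payoff C).
Proof.
have mD : measurable_fun setT (fun p : path_space R => debut C 0%:E p).
  apply: (@measurable_debut R _ (path_space R) (fun t p => p t) C (fun=> 0%:E)) => //.
  exact: measurable_coord.
apply: measurable_fun_limn_esup => n; apply/measurable_EFinP.
apply: measurable_fun_ifT => //.
  exact: measurable_fin_time.
apply: measurable_funM.
  apply: measurableT_comp measurable_discount_fun _.
  exact: measurableT_comp.
apply: measurableT_comp measurable_payoff_fun _.
apply: (measurable_eval_grid (Z := fun t (p : path_space R) => p t)).
  exact: measurableT_comp.
by move=> t t0; exact: measurable_coord.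
Qed.

End payoff.

(** * Stopping at a set after a stopping time *)

Section stopped_values.
Context d (T : measurableType d) (R : realType) (I : set R)
  (P : R -> probability T R) (X : R -> T -> R) (f delta : R -> R).
Context (hI : is_interval I) (hX : strong_markov_process I P X)
  (f0 : forall x, I x -> 0 <= f x) (cf : {within I, continuous f})
  (hd : discount_function delta).
Local Notation F := (right_limit_filtration (natural_filtration X)).

Lemma state_path_traj w : state_path I (X ^~ w).
Proof. by split; [exact: smp_continuous hX _|move=> t; exact: smp_state hX _ _]. Qed.

Lemma discounted_payoff_ge0 w t : 0 <= t -> 0 <= delta t * f (X t w).
Proof.
by move=> t0; rewrite mulr_ge0 ?(discount_ge0 hd)// f0//; exact: smp_state hX _ _ _.
Qed.

Lemma measurable_payoff_at (tau : T -> \bar R) : measurable_fun setT tau ->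
  (forall w, 0 <= tau w)%E -> measurable_fun setT (fun w => payoff_at f delta (tau w) (X ^~ w)).
Proof.
move=> mtau tau0.
have mft : measurable_fun setT (fine \o tau) by exact: measurableT_comp.
rewrite (_ : (fun w => _) = fun w => if (tau w < +oo)%E then
   (delta \_ `[0, +oo[) (fine (tau w)) * (f \_ I) (X (fine (tau w)) w) else 0).
  apply: measurable_fun_ifT => //; first exact: measurable_fin_time.
  apply: measurable_funM.
    exact: measurableT_comp (measurable_discount_fun hd) mft.
  apply: measurableT_comp (measurable_payoff_fun hI cf) _.
  apply: (measurable_eval mft) => [w|t t0|w].
  - by rewrite /= fine_ge0.
  - exact: smp_measurable hX _ t0.
  - exact: smp_continuous hX _.
apply/funext => w; have := tau0 w; rewrite /payoff_at; case: (tau w) => [t| |]//=.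
rewrite lee_fin ltry => t0; rewrite !patchE !mem_set//=.
  exact: smp_state hX _ _ _.
by rewrite in_itv/= t0.
Qed.

(* [J] with [debut] in place of [hitting_time] and with 0 in place of the
   limsup, see [J_value]. *)
Definition value (x : R) (C : set R) : \bar R :=
  (\int[P x]_w (payoff_at f delta (debut C 0%:E (X ^~ w)) (X ^~ w))%:E)%E.

(** With h = delta(tau), g1 the payoff of the path restarted at tau and g2 its expectation from
    X_tau: E[h f(X_tau)] <= E[h g2] by the bound on f, E[h g2] = E[h g1] by strong Markov, and
    E[h g1] is at most the right side by log sub-additivity. *)
Lemma stopped_value_step x tau C : I x -> stopping_time F tau ->
  closed (C : set (subspace I)) -> C `<=` I ->
  (forall y, I y -> ((f y)%:E <= value y C)%E) ->
  (\int[P x]_w (payoff_at f delta (tau w) (X ^~ w))%:E <=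
   \int[P x]_w (payoff_at f delta (debut C (tau w) (X ^~ w)) (X ^~ w))%:E)%E.
Proof.
move=> Ix st cC CI fC.
have mX := smp_measurable hX.
have mtau := stopping_time_measurable mX st.
have mft : measurable_fun setT (fine \o tau) by exact: measurableT_comp.
have ft0 w : 0 <= fine (tau w) by rewrite fine_ge0// st.1.
(* Where tau is infinite, [fine] returns 0 and the restarted path is meaningless; the weight 0
   discards it. *)
pose h w := if (tau w < +oo)%E then (delta \_ `[0, +oo[) (fine (tau w)) else 0.
have hE w : (tau w < +oo)%E -> h w = delta (fine (tau w)).
  by move=> tw; rewrite /h tw patchE mem_set//= in_itv/= ft0.
have h0 w : 0 <= h w.
  have [tw|] := boolP (tau w < +oo)%E; first by rewrite hE// (discount_ge0 hd).
  by rewrite /h => /negbTE ->.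
have mh : measurable_fun setT h.
  apply: measurable_fun_ifT => //; first exact: measurable_fin_time.
  exact: measurableT_comp (measurable_discount_fun hd) mft.
pose V : path_space R -> \bar R := path_payoff I f delta C.
have mV : measurable_fun setT V by exact: measurable_path_payoff.
have V0 p : (0 <= V p)%E by exact: path_payoff_ge0.
pose y w := X (fine (tau w)) w.
have Iy w : I (y w) by apply: smp_state hX _ _ _.
have my : measurable_fun setT y.
  apply: (measurable_eval mft) => //; exact: smp_continuous hX.
pose g1 w := V (fun t => X (fine (tau w) + t) w).
pose g2 w := (\int[P (y w)]_w' V (X ^~ w'))%E.
have mY : measurable_fun setT (fun w => (fun t => X (fine (tau w) + t) w) : path_space R).
  apply: measurable_path => t t0.
  apply: (measurable_eval (sigma := fun w => fine (tau w) + t)).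
  - exact: measurable_funD.
  - by move=> w; rewrite addr_ge0.
  - by move=> s s0; exact: mX.
  - exact: smp_continuous hX.
have mg1 : measurable_fun setT g1 by exact: measurableT_comp mV mY.
have g2E w : g2 w = giry_int (law hX (y w)) V by rewrite giry_int_map.
have mg2 : measurable_fun setT g2.
  rewrite (_ : g2 = (giry_int ^~ V) \o (fun w => law hX (y w))); last first.
    by apply/funext => w; rewrite g2E.
  apply: measurableT_comp; first exact: measurable_giry_int.
  exact: measurable_law.
have g2_val w : g2 w = value (y w) C.
  apply: eq_integral => w' _; exact: (path_payoffE delta cf C (state_path_traj w')).
apply: (@le_trans _ _ (\int[P x]_w ((h w)%:E * g2 w))%E).
  apply: ge0_le_integral => //.
  - by move=> w _; rewrite lee_fin; apply: (payoff_at_ge0 f0 hd _ (st.1 w)); exact: state_path_traj.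
  - by apply/measurable_EFinP; exact: measurable_payoff_at st.1.
  - by apply: emeasurable_funM => //; exact/measurable_EFinP.
  - move=> w _; rewrite /payoff_at; case tE : (tau w) => [t| |].
    + rewrite hE ?tE ?ltry//= EFinM g2_val /y tE/=; apply: lee_wpmul2l.
        by rewrite lee_fin (discount_ge0 hd)//; have := ft0 w; rewrite tE.
      apply: fC; have := Iy w; rewrite /y tE; exact.
    + by rewrite mule_ge0 ?lee_fin// integral_ge0.
    + by rewrite mule_ge0 ?lee_fin// integral_ge0.
(* The superlevel sets of delta(tau) are of the form {tau <= u}, on which the
   strong Markov property applies. *)
rewrite -(@eq_integral_weight _ _ _ (P x) h g1 g2)//; first last.
- move=> r r0; have [lev|[u u0 lev]] := discount_level hd r0.
    rewrite (_ : [set w | _] = set0) ?integral_set0//.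
    apply/seteqP; split => w //=; rewrite leNgt => /negP; apply.
    have [tw|] := boolP (tau w < +oo)%E; first by rewrite hE// lev.
    by rewrite /h => /negbTE ->.
  rewrite (_ : [set w | _] = [set w | (tau w <= u%:E)%E]).
    apply: (strong_markov_functional hI hX Ix st) => //.
      exact: stopped_le.
    by move=> w /= /le_lt_trans; apply; exact: ltry.
  apply/seteqP; split => w /=; have := st.1 w; case tE : (tau w) => [t| |]//=;
    rewrite ?lee_fin ?leey_eq.
  - by move=> t0; rewrite hE ?tE ?ltry// lev.
  - by move=> _; rewrite /h tE ltxx => /(lt_le_trans r0); rewrite ltxx.
  - by move=> t0; rewrite hE ?tE ?ltry// lev.
- by move=> w; apply: integral_ge0.
- by move=> w; exact: V0.
have mdeb : measurable_fun setT (fun w => debut C (tau w) (X ^~ w)).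
  exact: measurable_debut.
have deb0 w : (0 <= debut C (tau w) (X ^~ w))%E by exact: debut_ge0.
apply: ge0_le_integral => //.
- by move=> w _; rewrite mule_ge0 ?lee_fin//; exact: V0.
- by apply: emeasurable_funM => //; exact/measurable_EFinP.
- by apply/measurable_EFinP; exact: measurable_payoff_at.
(* The left side is 0 if tau is infinite or the restarted path never visits C. Otherwise the visit
   at s is the one at tau + s, and [discountD] applies. *)
move=> w _; have [tw|] := boolP (tau w < +oo)%E; last first.
  move=> tw; rewrite /h (negbTE tw) mul0e lee_fin.
  exact: payoff_at_ge0 (state_path_traj w) _.
have ns := state_path_shift (state_path_traj w) (ft0 w).
rewrite hE// /g1 /V (path_payoffE delta cf C ns) -EFinM lee_fin.
have t0 := ft0 w; have tE : tau w = (fine (tau w))%:E.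
  by rewrite fineK// ge0_fin_numE// st.1.
have := debut_ge0 C 0%:E (fun t => X (fine (tau w) + t) w).
case sE : (debut _ _ (fun t => X (fine (tau w) + t) w)) => [s| |]//; last first.
  by rewrite /= mulr0 => _; exact: payoff_at_ge0 (state_path_traj w) _.
rewrite lee_fin => s0; rewrite [in leRHS]tE.
rewrite (debut_shift (state_path_traj w) cC CI t0 sE)/= mulrA.
apply: ler_wpM2r; last exact: discountD.
by apply: f0; exact: ns.2.
Qed.

End stopped_values.

(** * Auxiliary facts on integrals, limits and paths *)

Section nonmeasurable_integral.
Local Open Scope ereal_scope.
Context d (T : measurableType d) (R : realType) (mu : {measure set T -> \bar R}).
Import HBNNSimple.

(* Measurability is not assumed: [stopped_payoff] contains a limsup over
   uncountably many times. *)
Lemma ge0_ae_le_integralT (g v : T -> \bar R) : (forall w, 0 <= g w) ->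
  (forall w, 0 <= v w) -> {ae mu, forall w, g w <= v w} ->
  \int[mu]_w g w <= \int[mu]_w v w.
Proof.
move=> g0 v0 [N [mN N0 gvN]]; rewrite !ge0_integralTE//.
apply: ge_ereal_sup => _ [h hg <-].
have mNC : measurable (~` N) by exact: measurableC.
(* A simple function below g, cut off on the null set N, lies below v and keeps its integral. *)
apply: ereal_sup_ubound; exists (proj_nnsfun h mNC) => /=.
  move=> w; rewrite /= mindicE; have [wN|wN] := boolP (w \in ~` N).
    rewrite mulr1; apply: le_trans (hg w) _.
    have [//|/negP wv] := boolP (g w <= v w).
    by move: wN; rewrite inE => /(_ (gvN _ wv)).
  by rewrite mulr0.
rewrite -!integralT_nnsfun; apply: ae_eq_integral => //.
- exact/measurable_EFinP.
- exact/measurable_EFinP.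
exists N; split => // w /=; apply: contra_notP => wN _.
by rewrite /= mindicE mem_set ?mulr1.
Qed.

Lemma ge0_ae_eq_integralT (g v : T -> \bar R) : (forall w, 0 <= g w) ->
  (forall w, 0 <= v w) -> {ae mu, forall w, g w = v w} ->
  \int[mu]_w g w = \int[mu]_w v w.
Proof.
move=> g0 v0 gv; apply/eqP; rewrite eq_le !ge0_ae_le_integralT//;
  by apply: filterS gv => w ->.
Qed.

End nonmeasurable_integral.

Section limf_esup_pinfty.
Context {R : realType}.

Lemma limf_esup_pinfty_ge0 (h : R -> R) : (forall t, 0 <= t -> 0 <= h t) ->
  (0 <= limf_esup (fun t => (h t)%:E) (pinfty_nbhs R))%E.
Proof.
move=> h0; apply: le_ereal_inf_tmp => _ [A [M [_ HM]] <-].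
apply: le_ereal_sup_tmp; exists (h (Num.max M 0 + 1))%:E.
  exists (Num.max M 0 + 1) => //; apply: HM.
  by rewrite (@le_lt_trans _ _ (Num.max M 0))// ?ltrDl// le_max lexx.
by rewrite lee_fin h0// addr_ge0// le_max lexx orbT.
Qed.

Lemma limf_esup_pinfty_cvg0 (h : R -> R) : (forall t, 0 <= t -> 0 <= h t) ->
  h t @[t --> +oo] --> 0 -> limf_esup (fun t => (h t)%:E) (pinfty_nbhs R) = 0%E.
Proof.
move=> h0 hc; apply/eqP; rewrite eq_le limf_esup_pinfty_ge0// andbT.
apply/lee_addgt0Pr => e e0; rewrite add0e.
move/cvgrPdist_lt : hc => /(_ _ e0) he.
apply: ge_ereal_inf; exists (ereal_sup [set (h t)%:E | t in [set t | `|0 - h t| < e]]).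
  by exists [set t | `|0 - h t| < e].
apply: ge_ereal_sup => _ [t /= ht <-]; rewrite lee_fin ltW//.
by move: ht; rewrite sub0r normrN; apply: le_lt_trans; exact: ler_norm.
Qed.

End limf_esup_pinfty.

Section sup_paths.
Context {R : realType}.
Implicit Types (p : R -> R).

Lemma sup_gt_rat p t x : 0 <= t -> {within `[0, +oo[, continuous p} ->
  x < sup [set p s | s in `[0, t]] <->
  exists2 q : rat, 0 <= (ratr q : R) <= t & x < p (ratr q).
Proof.
move=> t0 pc; split.
  move/sup_gt => [|_ [s + <-]].
    by exists (p 0), 0 => //=; rewrite in_itv/= lexx.
  rewrite /= in_itv/= => st xs.
  have e0 : 0 < p s - x by rewrite subr_gt0.
  have s0 : `[0, +oo[%classic s by rewrite /= in_itv/=; case/andP: st => ->.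
  have [e e1 He] := within_continuous_eps pc s0 e0.
  have [q qt qs] := rat_near_le st e1; exists q => //.
  have := He (ratr q); rewrite /= in_itv/=; case/andP: qt => -> _ /(_ isT qs).
  by rewrite ltr_distl; lra.
move=> [q qt] /lt_le_trans; apply; apply: ub_le_sup; last by exists (ratr q).
(* The real [sup] dominates its set only if an upper bound exists; the maximum on [0, t] provides
   one. *)
have [|c _ Hc] := EVT_max t0 (f := p).
  apply: continuous_subspaceW pc => s /=; rewrite !in_itv/= => /andP[-> //].
by exists (p c) => _ [s st <-]; apply: Hc.
Qed.

Lemma IVT_between p a b x : 0 <= a -> 0 <= b ->
  {within `[0, +oo[, continuous p} -> p a < x -> x < p b ->
  exists2 c, Num.min a b <= c <= Num.max a b & p c = x.
Proof.
move=> a0 b0 pc pa pb; have ab : Num.min a b <= Num.max a b.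
  by rewrite ge_min !le_max !lexx.
have [||c cab pcx] := @IVT R p _ _ x ab.
- apply: continuous_subspaceW pc => s /=; rewrite !in_itv/= => /andP[h _].
  by rewrite andbT (le_trans _ h)// le_min a0.
- have [ab'|ab'] := leP a b.
    by rewrite ge_min le_max (ltW pa) (ltW pb) orbT.
  by rewrite ge_min le_max (ltW pa) (ltW pb) orbT.
by exists c => //; move: cab; rewrite in_itv.
Qed.

Lemma within_continuous_payoff (I : set R) (f delta p : R -> R) : {within I, continuous f} ->
  {within `[0, +oo[, continuous delta} -> state_path I p ->
  {within `[0, +oo[, continuous (fun t => delta t * f (p t))}.
Proof.
move=> cf cd [pc pI].
have fpc : {within `[0, +oo[, continuous (fun t => f (p t))}.
  apply: eps_within_continuous => s s0 e e0.
  have s1 : 0 <= s by move: s0; rewrite /= in_itv/= andbT.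
  have [e1 e10 H1] := within_continuous_eps cf (pI _ s1) e0.
  have [e2 e20 H2] := within_continuous_eps pc s0 e10.
  exists e2 => // u u0 us; apply: H1; last exact: H2.
  by apply: pI; move: u0; rewrite /= in_itv/= andbT.
by move=> t; apply: cvgM; [exact: cd|exact: fpc].
Qed.

End sup_paths.

(** * Alternating visits *)

Section alternating_chain.
Context {R : realType} (I : set R) (f delta : R -> R).
Context (cf : {within I, continuous f}) (hd : discount_function delta).
Context (A B : set R) (cA : closed (A : set (subspace I)))
  (cB : closed (B : set (subspace I))) (AI : A `<=` I) (BI : B `<=` I).
Implicit Types (p : R -> R).

Definition alternate (n : nat) := if odd n then B else A.

(** Index 0 is the starting time, not a visit; odd indices are visits to A, positive even ones
    visits to B. *)
Fixpoint chain p n : \bar R :=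
  if n is m.+1 then debut (alternate m) (chain p m) p else 0%:E.

Lemma closed_alternate n : closed (alternate n : set (subspace I)).
Proof. by rewrite /alternate; case: ifP. Qed.

Lemma sub_alternate n : alternate n `<=` I.
Proof. by rewrite /alternate; case: ifP. Qed.

Lemma chain_ge0 p n : (0 <= chain p n)%E.
Proof. by case: n => [//|n] /=; exact: debut_ge0. Qed.

Lemma chain_leS p n : state_path I p -> (chain p n <= chain p n.+1)%E.
Proof.
move=> pn /=; have := debut_ge0 (alternate n) (chain p n) p.
case D : (debut _ _ _) => [t| |]// _; last by rewrite leey.
by have [] := debut_fin pn (@closed_alternate n) (@sub_alternate n) D.
Qed.

Lemma chain_le p m n : state_path I p -> (m <= n)%N -> (chain p m <= chain p n)%E.
Proof.
move=> pn; elim: n => [|n IH]; first by rewrite leqn0 => /eqP ->.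
rewrite leq_eqVlt ltnS => /predU1P[->//|/IH/le_trans]; apply.
exact: chain_leS.
Qed.

(** A first visit t of the intersection is a visit to whichever set comes next, so by induction no
    term of the chain passes t. *)
Lemma chain_le_debutI p n : state_path I p -> (chain p n <= debut (A `&` B) 0%:E p)%E.
Proof.
move=> pn; have := debut_ge0 (A `&` B) 0%:E p.
case D : (debut _ _ _) => [t| |]//; last by rewrite !leey.
have cAB : closed (A `&` B : set (subspace I)) by exact: (@closedI (subspace I) A B).
have [t0 _ [At Bt]] := debut_fin pn cAB (fun _ h => AI h.1) D.
move=> _; elim: n => [//|n IH] /=.
apply: (debut_le pn) => //; rewrite /alternate; case: ifP => //.
Qed.

Lemma chain_cvg p : state_path I p -> delta t * f (p t) @[t --> +oo] --> 0 ->
  payoff_at f delta (chain p n) p @[n --> \oo] --> payoff_at f delta (debut (A `&` B) 0%:E p) p.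
Proof.
move=> pn p0.
(* Once infinite, the chain stays so; the payoff is then eventually 0, and the intersection is never
   visited. *)
have [[N tN]|fin] := pselect (exists N, chain p N = +oo%E).
  have -> : debut (A `&` B) 0%:E p = +oo%E.
    by apply/eqP; rewrite -leye_eq -tN; exact: chain_le_debutI.
  apply: cvg_near_cst; exists N => // n /= Nn.
  suff -> : chain p n = +oo%E by [].
  by apply/eqP; rewrite -leye_eq -tN; exact: chain_le.
pose t n := fine (chain p n).
have tE n : chain p n = (t n)%:E.
  rewrite /t fineK// ge0_fin_numE ?chain_ge0// ltey; apply/eqP => h.
  by apply: fin; exists n.
have t0 n : 0 <= t n by rewrite -lee_fin -tE chain_ge0.
have tnd : nondecreasing_seq t.
  by move=> m n mn; rewrite -lee_fin -!tE; exact: chain_le.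
have Ct n : alternate n (p (t n.+1)).
  by have [] := debut_fin pn (@closed_alternate n) (@sub_alternate n) (tE n.+1).
have payE n : payoff_at f delta (chain p n) p = delta (t n) * f (p (t n)) by rewrite tE.
rewrite (_ : (fun n => payoff_at _ _ _ _) = (fun s => delta s * f (p s)) \o t); last first.
  by apply/funext => n /=; rewrite payE.
(* A divergent monotone chain tends to infinity: the intersection is never visited and [p0] gives
   the limit 0. *)
have [tc|/(nondecreasing_dvgn_lt tnd) tdv] := pselect (cvgn t); last first.
  rewrite (_ : debut _ _ _ = +oo%E); first exact: cvg_comp tdv p0.
  have Dt n : ((t n)%:E <= debut (A `&` B) 0%:E p)%E.
    by rewrite -tE; exact: chain_le_debutI.
  case D : (debut _ _ _) Dt => [s| |]// Dt.
    have /cvgryPge/(_ (s + 1))[N _ /(_ N (leqnn N))/=] := tdv.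
    move=> h; exfalso; have := Dt N; rewrite lee_fin => /(le_trans h).
    by rewrite gerDl ler10.
  by have := Dt 0%N.
pose s := limn t.
have s0 : 0 <= s by apply: limr_ge => //; exact: nearW.
have ts n : t n <= s by exact: nondecreasing_cvgn_le.
have s0' : `[0, +oo[%classic s by rewrite /= in_itv/= s0.
have t0' n : `[0, +oo[%classic (t n) by rewrite /= in_itv/= t0.
have pts : p \o t @ \oo --> p s by exact: (within_continuous_cvg pn.1 s0').
have lim_in C : closed (C : set (subspace I)) -> C `<=` I ->
    (forall N, exists2 n, (N <= n)%N & C (p (t n))) -> C (p s).
  move=> cC CI CN; apply: (closed_subspace_approx cC) => //; first exact: pn.2.
  move=> e e0; move/cvgrPdist_lt : pts => /(_ _ e0)[N _ HN].
  by have [n Nn Cn] := CN N; exists (p (t n)) => //; exact: HN.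
(* The odd-indexed terms lie in A and the positive even-indexed ones in B; both subsequences
   converge to the same point p s. *)
have As : A (p s).
  apply: lim_in => // N; exists (N.*2).+1; first by rewrite -addnn -addnS leq_addr.
  by have := Ct N.*2; rewrite /alternate odd_double.
have Bs : B (p s).
  apply: lim_in => // N; exists (N.*2).+2; first by rewrite -addnn -!addnS leq_addr.
  by have := Ct N.*2.+1; rewrite /alternate /= odd_double.
have -> : debut (A `&` B) 0%:E p = s%:E.
  apply/eqP; rewrite eq_le (debut_le pn)//=.
  have Dt n : ((t n)%:E <= debut (A `&` B) 0%:E p)%E.
    by rewrite -tE; exact: chain_le_debutI.
  case D : (debut _ _ _) Dt => [u| |]// Dt.
  - by rewrite lee_fin; apply: limr_le => //; apply: nearW => n; rewrite -lee_fin.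
  - by rewrite leey.
  - by have := Dt 0%N.
have cg := within_continuous_payoff cf (discount_continuous hd) pn.
exact: (within_continuous_cvg cg s0').
Qed.

End alternating_chain.

(** * Equilibria *)

Section running_sup.
Context d (T : measurableType d) (R : realType) (Z : R -> T -> R).
Context (mZ : forall t, 0 <= t -> measurable_fun setT (Z t))
  (cZ : forall w, {within `[0, +oo[, continuous (Z ^~ w)}).

Lemma measurable_sup_gt t x : 0 <= t ->
  measurable [set w | x < sup [set Z s w | s in `[0, t] ] ].
Proof.
move=> t0; rewrite (_ : [set w | _] =
  \bigcup_(q in [set q : rat | 0 <= (ratr q : R) <= t]) [set w | x < Z (ratr q) w]).
  rewrite bigcup_mkcond; apply: bigcupT_measurable_rat => q.
  case: ifPn => //; rewrite inE/= => /andP[q0 _].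
  rewrite (_ : [set w | _] = Z (ratr q) @^-1` `]x, +oo[%classic).
    by rewrite -[X in measurable X]setTI; exact: mZ.
  by apply/seteqP; split => w /=; rewrite in_itv/= andbT.
by apply/seteqP; split => w /=; rewrite (sup_gt_rat _ t0 (@cZ w)) => -[q]; exists q.
Qed.

Lemma measurable_ereal_sup_path :
  measurable_fun setT (fun w => ereal_sup [set (Z t w)%:E | t in `[0, +oo[ ]).
Proof.
apply: (measurability _ (ErealGenOInfty.measurableE R)) => _ [_ [s ->] <-].
rewrite setTI (_ : _ @^-1` _ =
  \bigcup_(q in [set q : rat | 0 <= (ratr q : R)]) [set w | s < Z (ratr q) w]).
  rewrite bigcup_mkcond; apply: bigcupT_measurable_rat => q.
  case: ifPn => //; rewrite inE/= => q0.
  rewrite (_ : [set w | _] = Z (ratr q) @^-1` `]s, +oo[%classic).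
    by rewrite -[X in measurable X]setTI; exact: mZ.
  by apply/seteqP; split => w /=; rewrite in_itv/= andbT.
apply/seteqP; split => w /=; rewrite in_itv/= andbT.
  move/ereal_sup_gt => [_ [t t0 <-]]; rewrite lte_fin => sZ.
  have e0 : 0 < Z t w - s by rewrite subr_gt0.
  have [e e1 He] := within_continuous_eps (@cZ w) t0 e0.
  move: t0; rewrite /= in_itv/= andbT => t0.
  have tt : 0 <= t <= t by rewrite t0 lexx.
  have [q /andP[q0 _] qs] := rat_near_le tt e1; exists q => //=.
  have := He (ratr q); rewrite /= in_itv/= q0 => /(_ isT qs).
  by rewrite ltr_distl; lra.
move=> [q q0 sZ]; apply: (@lt_le_trans _ _ (Z (ratr q) w)%:E); first by rewrite lte_fin.
by apply: ereal_sup_ubound; exists (ratr q) => //=; rewrite in_itv/= andbT.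
Qed.

End running_sup.

Section equilibria.
Context d (T : measurableType d) (R : realType) (I : set R)
  (P : R -> probability T R) (X : R -> T -> R) (f delta : R -> R).
Context (hI : is_interval I) (hX : strong_markov_process I P X)
  (f0 : forall x, I x -> 0 <= f x) (cf : {within I, continuous f})
  (hd : discount_function delta)
  (ha : forall x t : R, I x -> 0 < t ->
       P x [set w | x < sup [set X s w | s in `[0, t] ] ] = 1%E /\
       P x [set w | inf [set X s w | s in `[0, t] ] < x] = 1%E)
  (hb : forall x : R, I x ->
       {ae P x, forall w, delta t * f (X t w) @[t --> +oo] --> 0})
  (hc : forall x : R, I x ->
       (\int[P x]_w ereal_sup [set (delta t * f (X t w))%:E | t in `[0%R, +oo[ ]
         < +oo)%E).

Lemma ae_probability1 x (E : set T) : measurable E -> P x E = 1%E ->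
  {ae P x, forall w, E w}.
Proof.
move=> mE PE; exists (~` E); split => //; first exact: measurableC.
by rewrite probability_setC// PE subee.
Qed.

Lemma ae_start x : I x -> {ae P x, forall w, X 0 w = x}.
Proof.
move=> Ix; apply: ae_probability1 (smp_start hX Ix).
rewrite (_ : [set w | _] = X 0 @^-1` [set x])//.
by rewrite -[X in measurable X]setTI; apply: (smp_measurable hX).
Qed.

(** By (a) the path is above and below x within every [0, 1/(n+1)], so it crosses x between two such
    times. *)
Lemma ae_return x : I x ->
  {ae P x, forall w e, 0 < e -> exists2 u, 0 < u <= e & X u w = x}.
Proof.
move=> Ix; have mX := smp_measurable hX; have cX := smp_continuous hX.
have n0 n : 0 < n.+1%:R^-1 :> R by rewrite invr_gt0.
have up : {ae P x, forall w n,
    x < sup [set X s w | s in `[0, n.+1%:R^-1] ]}.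
  apply: ae_foralln => n; apply: ae_probability1 (ha Ix (n0 n)).1.
  by apply: measurable_sup_gt => //; exact: ltW.
have infE w t : inf [set X s w | s in `[0, t] ] =
    - sup [set - X s w | s in `[0, t] ].
  by rewrite /inf image_comp.
have dn : {ae P x, forall w n,
    - x < sup [set - X s w | s in `[0, n.+1%:R^-1] ]}.
  apply: ae_foralln => n.
  have := (ha Ix (n0 n)).2; rewrite (_ : [set w | _] =
    [set w | - x < sup [set - X s w | s in `[0, n.+1%:R^-1] ] ]); last first.
    by apply/seteqP; split => w /=; rewrite infE ltrNl.
  apply: ae_probability1; apply: (measurable_sup_gt (Z := fun s w => - X s w)) => //.
  - by move=> t t0; apply: measurableT_comp => //; exact: mX.
  - by move=> w t; apply: cvgN; exact: cX.
apply: filterS3 (ae_start Ix) up dn => w X0 up dn e e0.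
have [n _ Hn] := near_infty_natSinv_lt (PosNum e0).
have {Hn} ne := ltW (Hn n (leqnn n)).
have ncX : {within `[0, +oo[, continuous (fun s => - X s w)}.
  by move=> t; apply: cvgN; exact: cX.
have /(sup_gt_rat _ (ltW (n0 n)) (cX w))[a /andP[a0 an] xa] := up n.
have /(sup_gt_rat _ (ltW (n0 n)) ncX)[b /andP[b0 bn]] := dn n.
rewrite ltrN2 => xb.
have [c /andP[c1 c2] Xc] := IVT_between b0 a0 (cX w) xb xa.
exists c => //; apply/andP; split.
  (* Neither time is 0: the path equals x at 0 and differs from x at both. *)
  apply: lt_le_trans c1; rewrite lt_min !lt_neqAle b0 a0 !andbT.
  by apply/andP; split; apply/eqP => h; [move: xb|move: xa]; rewrite -h X0 ltxx.
by apply: le_trans c2 _; rewrite ge_max (le_trans bn) ?(le_trans an).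
Qed.

Lemma hitting_time_ge0 C w : (0 <= hitting_time X C w)%E.
Proof. by apply: le_ereal_inf_tmp => _ [t [/ltW t0 _] <-]; rewrite lee_fin. Qed.

(** The two times can differ only for a path starting in C, where [debut] is 0; immediate returns
    make [hitting_time] 0 as well. *)
Lemma hitting_time_debut C w : closed (C : set (subspace I)) -> C `<=` I ->
  (C (X 0 w) -> forall e, 0 < e -> exists2 u, 0 < u <= e & C (X u w)) ->
  hitting_time X C w = debut C 0%:E (X ^~ w).
Proof.
move=> cC CI ret; have pn := state_path_traj hX w.
apply/eqP; rewrite eq_le; apply/andP; split; last first.
  apply: le_ereal_inf_tmp => _ [t [/ltW t0 Ct] <-].
  by apply: (debut_le pn) => //; rewrite lee_fin.
case D : (debut _ _ _) => [t| |].
- have [+ _ Ct] := debut_fin pn cC CI D.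
  rewrite (le_eqVlt 0 t) => /predU1P[t0|t0]; last by apply: ereal_inf_lbound; exists t.
  move: Ct; rewrite -t0 => /ret {}ret; apply/lee_addgt0Pr => e /ret[u /andP[u0 ue] Cu].
  by apply: ge_ereal_inf; exists u%:E; [exists u|rewrite add0e lee_fin].
- by rewrite leey.
- by have := debut_ge0 C 0%:E (X ^~ w); rewrite D.
Qed.

(** Here (a) identifies the times and (b) the payoffs at infinity, both almost surely; the
    comparison lemma for possibly nonmeasurable integrands does the rest. *)
Lemma J_value x C : I x -> closed (C : set (subspace I)) -> C `<=` I ->
  J P X f delta x C = value P X f delta x C.
Proof.
move=> Ix cC CI; have dfge0 := discounted_payoff_ge0 hX f0 hd.
apply: ge0_ae_eq_integralT.
- move=> w; rewrite /stopped_payoff.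
  have := hitting_time_ge0 C w; case: (hitting_time X C w) => [t| |].
  + by rewrite !lee_fin; exact: dfge0.
  + by move=> _; apply: limf_esup_pinfty_ge0; exact: dfge0.
  + by move=> _; apply: limf_esup_pinfty_ge0; exact: dfge0.
- by move=> w; rewrite lee_fin; apply: payoff_at_ge0 (state_path_traj hX w) (debut_ge0 _ _ _).
apply: filterS3 (ae_start Ix) (ae_return Ix) (hb Ix) => w X0 ret lim0.
rewrite /stopped_payoff (hitting_time_debut cC CI).
  case D : (debut _ _ _) => [t| |]//.
  - by rewrite limf_esup_pinfty_cvg0//; exact: dfge0.
  - by have := debut_ge0 C 0%:E (X ^~ w); rewrite D.
by rewrite X0 => Cx e /ret[u u0 Xu]; exists u => //; rewrite Xu.
Qed.

Lemma value_mem x C : I x -> C x -> value P X f delta x C = (f x)%:E.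
Proof.
move=> Ix Cx; rewrite -[RHS]mule1 -(@probability_setT _ _ _ (P x)) -integral_cst//.
apply: ge0_ae_eq_integralT.
- by move=> w; rewrite lee_fin; apply: payoff_at_ge0 (state_path_traj hX w) (debut_ge0 _ _ _).
- by move=> w; rewrite lee_fin f0.
apply: filterS (ae_start Ix) => w X0.
have -> : debut C 0%:E (X ^~ w) = 0%:E.
  apply/eqP; rewrite eq_le debut_ge0 andbT.
  by apply: debut_le (state_path_traj hX w) _ _ _; rewrite ?X0.
by rewrite /payoff_at X0 (discount0 hd) mul1r.
Qed.

(** A point with f y > J(y, C) lies in the stopping region, hence in C, where the value is f y: a
    contradiction. *)
Lemma equilibrium_le_value C : closed (C : set (subspace I)) ->
  equilibrium I P X f delta C ->
  forall y, I y -> ((f y)%:E <= value P X f delta y C)%E.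
Proof.
move=> cC [_ CI ThC] y Iy; rewrite leNgt; apply/negP => h.
have Cy : C y by rewrite -ThC; left; split => //; rewrite J_value.
by move: h; rewrite value_mem// ltxx.
Qed.

Lemma discounted_sup_ge0 w :
  (0 <= ereal_sup [set (delta t * f (X t w))%:E | t in `[0%R, +oo[ ])%E.
Proof.
apply: le_ereal_sup_tmp; exists (delta 0 * f (X 0 w))%:E.
  by exists 0 => //=; rewrite in_itv/= lexx.
by rewrite lee_fin; exact: (discounted_payoff_ge0 hX f0 hd).
Qed.

Lemma integrable_sup x : I x -> (P x).-integrable setT
  (fun w => ereal_sup [set (delta t * f (X t w))%:E | t in `[0, +oo[ ]).
Proof.
move=> Ix.
apply/integrableP; split.
  apply: (measurable_ereal_sup_path (Z := fun t w => delta t * f (X t w))).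
    move=> t t0; apply: measurable_funM => //.
    rewrite (_ : (fun w => f (X t w)) = (f \_ I) \o X t).
      apply: measurableT_comp (measurable_payoff_fun hI cf) _.
      exact: smp_measurable hX _ t0.
    by apply/funext => w /=; rewrite patchE mem_set//; exact: smp_state hX _ _ t0.
  move=> w; apply: within_continuous_payoff cf (discount_continuous hd) (state_path_traj hX w).
under eq_integral => w _.
  rewrite (gee0_abs (discounted_sup_ge0 w)); over.
exact: hc.
Qed.

Lemma value_le_setI x A B : I x ->
  closed (A : set (subspace I)) -> closed (B : set (subspace I)) ->
  equilibrium I P X f delta A -> equilibrium I P X f delta B ->
  (value P X f delta x A <= value P X f delta x (A `&` B))%E.
Proof.
move=> Ix cA cB eA eB; have [_ AI _] := eA; have [_ BI _] := eB.
have mX := smp_measurable hX.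
pose tau n w := chain A B (X ^~ w) n.
have st n : stopping_time (right_limit_filtration (natural_filtration X)) (tau n).
  elim: n => [|n IH]; first exact: stopping_time_cst0.
  exact: stopping_time_debut.
have falt n y : I y -> ((f y)%:E <= value P X f delta y (alternate A B n))%E.
  by rewrite /alternate; case: ifP => _; exact: equilibrium_le_value.
pose v n := (\int[P x]_w (payoff_at f delta (tau n w) (X ^~ w))%:E)%E.
have vS n : (v n <= v n.+1)%E.
  apply: (stopped_value_step hI hX f0 cf hd Ix (st n)).
  - exact: closed_alternate.
  - exact: sub_alternate.
  - exact: falt.
(* The base case holds by computation: [tau 1] is the debut of A from time 0. *)
have v1 n : (value P X f delta x A <= v n.+1)%E.
  by elim: n => [//|n IH]; exact: le_trans IH (vS _).
have mpay n : measurable_fun setT (fun w => (payoff_at f delta (tau n w) (X ^~ w))%:E).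
  apply/measurable_EFinP; apply: (measurable_payoff_at hI hX cf hd).
    exact: stopping_time_measurable mX (st n).
  exact: (st n).1.
have mlim : measurable_fun setT (fun w =>
    (payoff_at f delta (debut (A `&` B) 0%:E (X ^~ w)) (X ^~ w))%:E).
  apply/measurable_EFinP; apply: (measurable_payoff_at hI hX cf hd).
    exact: measurable_debut.
  by move=> w; exact: debut_ge0.
have cvg_pay : {ae P x, forall w, setT w ->
    (fun n => (payoff_at f delta (tau n w) (X ^~ w))%:E) @ \oo -->
    (payoff_at f delta (debut (A `&` B) 0%:E (X ^~ w)) (X ^~ w))%:E}.
  apply: filterS (hb Ix) => w lim0 _.
  apply: cvg_EFin; first by apply: nearW.
  exact: (chain_cvg cf hd cA cB AI BI (state_path_traj hX w) lim0).
have dom : {ae P x, forall w n, setT w -> (`|(payoff_at f delta (tau n w) (X ^~ w))%:E| <=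
    ereal_sup [set (delta t * f (X t w))%:E | t in `[0%R, +oo[ ])%E}.
  apply: aeW => w n _; have := (st n).1 w.
  rewrite /payoff_at; case: (tau n w) => [t| |]//=; rewrite ?normr0 ?discounted_sup_ge0//.
  rewrite lee_fin => t0.
  rewrite ger0_norm ?(discounted_payoff_ge0 hX f0 hd)//.
  by apply: ereal_sup_ubound; exists t => //=; rewrite in_itv/= t0.
have [_ _ vlim] := dominated_convergence measurableT mpay mlim cvg_pay
  (integrable_sup Ix) dom.
rewrite [leRHS](_ : _ = limn v); last by apply/esym/cvg_lim.
apply: lime_ge; first by apply/cvg_ex; eexists; exact: vlim.
(* The bound starts at index 1: [v 0] is the payoff of stopping at once, which may be smaller. *)
by exists 1%N => // -[//|n] _; exact: v1.
Qed.

(** The stopping region of the intersection is empty, since f <= J(., A) <= J(., A and B); on the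
    intersection itself J equals f. *)
Lemma closed_equilibrium_setI A B :
  closed (A : set (subspace I)) -> closed (B : set (subspace I)) ->
  equilibrium I P X f delta A -> equilibrium I P X f delta B ->
  equilibrium I P X f delta (A `&` B).
Proof.
move=> cA cB eA eB; have [mA AI _] := eA; have [mB BI _] := eB.
have cAB : closed (A `&` B : set (subspace I)) by exact: (@closedI (subspace I) A B).
have ABI : A `&` B `<=` I by move=> y [/AI].
split => //; first exact: measurableI.
apply/seteqP; split => [y [[Iy]|[_ //]]|y ABy].
  rewrite J_value// => /(le_lt_trans (value_le_setI Iy cA cB eA eB)).
  by rewrite ltNge equilibrium_le_value.
have Iy := ABI _ ABy; right; split => //; split => //.
by rewrite J_value// value_mem.
Qed.

End equilibria.

Theorem proposition4p1 (d : measure_display) (T : measurableType d)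
    (R : realType) (I : set R) (P : R -> probability T R) (X : R -> T -> R)
    (f delta : R -> R)
    (hI : is_interval I)
    (hX : strong_markov_process I P X)
    (hf_ge0 : forall x : R, I x -> 0 <= f x)
    (hf_cont : {within I, continuous f})
    (hdelta : discount_function delta)
    (ha : forall x t : R, I x -> 0 < t ->
       P x [set w | x < sup [set X s w | s in `[0, t] ] ] = 1%E /\
       P x [set w | inf [set X s w | s in `[0, t] ] < x] = 1%E)
    (hb : forall x : R, I x ->
       {ae P x, forall w, delta t * f (X t w) @[t --> +oo] --> 0})
    (hc : forall x : R, I x ->
       (\int[P x]_w ereal_sup [set (delta t * f (X t w))%:E | t in `[0%R, +oo[ ]
         < +oo)%E)
    (A B : set R)
    (hA_closed : closed (A : set (subspace I)))
    (hB_closed : closed (B : set (subspace I)))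
    (hA : equilibrium I P X f delta A)
    (hB : equilibrium I P X f delta B) :
  (forall x : R, I x ->
     (maxe (J P X f delta x A) (J P X f delta x B)
        <= J P X f delta x (A `&` B))%E) /\
  equilibrium I P X f delta (A `&` B).
Proof.
have [_ AI _] := hA; have [_ BI _] := hB.
have cAB : closed (A `&` B : set (subspace I)) by exact: (@closedI (subspace I) A B).
have ABI : A `&` B `<=` I by move=> y [/AI].
split; last exact: (closed_equilibrium_setI hI hX hf_ge0 hf_cont hdelta ha hb hc).
move=> x Ix; rewrite !(J_value hX hf_ge0 hdelta ha hb Ix)// ge_max.
(* The bound for B is the same lemma with the roles exchanged, the chain now starting with B. *)
rewrite (value_le_setI hI hX hf_ge0 hf_cont hdelta ha hb hc)//= [A `&` B]setIC.
exact: (value_le_setI hI hX hf_ge0 hf_cont hdelta ha hb hc).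
Qed.
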